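(* Let $G$ be a finite abelian group of order $g$, and let $p(G)$ denote the smallest prime divisor of $g$. Let $G[2]=\{\alpha\in G: 2\alpha=0\}$. Assume that: if $p(G)=2$, then $g\ge 624\,|G[2]|+1846$; if $p(G)=3$, then $g\ge 3705$; if $p(G)=5$, then $g\ge 6175$; if $p(G)\ge 7$, then $g\ge 46319$. If $A\subseteq G$ satisfies $|A|>g/2$, then $\Gamma_k(A)=G$ for every integer $k$ with $3\le k\le |A|-3$.
   Context: For a finite abelian group $G$, a subset $A\subseteq G$ and an integer $0\le k\le |A|$, the restricted $k$-sumset is $\Gamma_k(A)=\{\alpha_1+\cdots+\alpha_k:\ \alpha_1,\dots,\alpha_k\in A \text{ pairwise distinct}\}$, with $\Gamma_0(A)=\{0\}$. *)

(* Defs.v *)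
From HB Require Import structures.
From mathcomp Require Import all_boot all_order all_algebra.

Set Implicit Arguments.
Unset Strict Implicit.
Unset Printing Implicit Defensive.

Import GRing.Theory.

Local Open Scope ring_scope.

Section RestrictedSumset.

Variable G : finZmodType.

(* The k-tuple t lists the pairwise distinct summands alpha_1, ..., alpha_k. *)
Definition restricted_sumset (k : nat) (A : {set G}) : {set G} :=
  [set \sum_(x <- t) x | t : k.-tuple G & uniq t && all [in A] t].

Lemma restricted_sumset0 (A : {set G}) : restricted_sumset 0 A = [set 0].
Proof.
apply/setP => y; rewrite inE; apply/imsetP/eqP => [[t _ ->]|->].
  by rewrite tuple0 big_nil.
by exists [tuple]; rewrite ?inE // big_nil.
Qed.

Definition two_torsion : {set G} := [set x : G | x *+ 2 == 0].

(* For the trivial group, which has no prime divisor, pdiv gives 1. *)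
Definition smallest_prime_divisor : nat := pdiv #|G|.

End RestrictedSumset.

Arguments two_torsion G : clear implicits.
Arguments smallest_prime_divisor G : clear implicits.

(* Main.v *)
Require Import Defs.
From mathcomp Require Import all_boot all_order all_algebra.
From mathcomp Require Import zify.

(* The map S |-> A \ S exchanges k and |A| - k, so let k <= |A|/2. Some z has at
   least k elements c of A with z - c in A and z - c <> c; disjoint pairs
   {c, z - c} serve as filler of known sum, reducing k summands to 3 summands
   taken from A' = A \ F with |F| <= 4.
   If x is not a sum of 3 distinct elements of A', then for b in A' the element
   x - b has at most |G[2]| + 2 representations as a sum over A'. As |A'| is about
   g/2, almost every z outside x - A' then has nearly |A'| representations, so A'
   is nearly invariant under translation by the differences of such z. The
   near-periods of A' form a subgroup L, which cannot be G, so it has index 2, and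
   A' nearly fills a coset of L. This is impossible for odd g; for even g, filling
   with pairs inside that coset and using at most one element of A outside it
   yields x directly. *)

Set Implicit Arguments.
Unset Strict Implicit.
Unset Printing Implicit Defensive.

Import GRing.Theory.

(* Arithmetic form of: the average of |A \ (A + h)| over h in G exceeds 3e. *)
Lemma not_almost_invariant a g t e : g <= 2 * a + 7 -> 190 * (t + 12) <= g ->
  2 * a <= g + t + 2 -> e * 25 <= 2 * g -> a * (g - a) <= g * (3 * e) -> False.
Proof.
move=> gA tG ag e25 h.
(* [d] is |2a - g|. Then 4a(g - a) = g^2 - d^2 is almost g^2, while [e25] bounds 12e by 24g/25. *)
have [d [d190 dE]] : exists d, d * 190 <= g /\ (2 * a = g + d \/ 2 * a + d = g).
  have [le|lt] := leqP g (2 * a); [exists (2 * a - g) | exists (g - 2 * a)];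
    by split; lia.
have E4 : 4 * (a * (g - a)) + d * d = g * g by case: dE; nia.
have : d * d * 190 <= g * g by nia.
have : g * (e * 25) <= g * (2 * g) by rewrite leq_mul2l e25 orbT.
have : 0 < g * g by nia.
lia.
Qed.

(** As e <= 4k/25, the quadratic inequality forces c <= k/5 or c >= 4k/5; since c is at least about
    k/2, the first is excluded. *)
Lemma dense_of_almost_invariant a g c k e : k * 2 = g -> g <= 2 * a + 7 ->
  a <= 2 * c -> 2280 <= g -> e * 25 <= 2 * g -> c <= k ->
  c * (k - c) <= k * e -> 4 * k <= 5 * c.
Proof.
move=> kg ga ac g0 e25 ck h; rewrite leqNgt; apply/negP => lt.
have : 25 * (c * (k - c)) <= k * (4 * k).
  have : k * (e * 25) <= k * (2 * g) by rewrite leq_mul2l e25 orbT.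
  by rewrite -kg; lia.
have [c' E] : exists c', c + c' = k by exists (k - c); lia.
have -> : k - c = c' by lia.
have : 0 < (5 * c - k) * (4 * k - 5 * c) by rewrite muln_gt0; lia.
nia.
Qed.

Section Sumsets.

Local Open Scope ring_scope.

Variable G : finZmodType.
Implicit Types (A C F S : {set G}) (x y z : G).

(** * Restricted sumsets as subset sums *)

Lemma restricted_sumsetP k A y :
  reflect (exists S : {set G},
             [/\ S \subset A, #|S| = k & \sum_(x in S) x = y])
          (y \in restricted_sumset k A).
Proof.
apply: (iffP imsetP) => [[t] | [S [sSA cS <-]]].
  rewrite inE => /andP[ut /allP At] ->; exists [set x in t]; split.
  - by apply/subsetP => x; rewrite inE => /At.
  - by rewrite cardsE (card_uniqP ut) size_tuple.
  - by rewrite [RHS]big_uniq //=; apply: eq_bigl => x; rewrite inE.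
have sz : size (enum S) == k by rewrite -cardE cS.
exists (Tuple sz); last by rewrite /= big_enum.
rewrite inE /= enum_uniq; apply/allP => x; rewrite mem_enum => xS.
exact: (subsetP sSA).
Qed.

Lemma restricted_sumset_compl k A y : (k <= #|A|)%N ->
  \sum_(x in A) x - y \in restricted_sumset (#|A| - k) A ->
  y \in restricted_sumset k A.
Proof.
move=> kA /restricted_sumsetP[S [sSA cS sumS]]; apply/restricted_sumsetP.
exists (A :\: S); split; first exact: subsetDl.
  by rewrite cardsD (setIidPr sSA) cS subKn.
have E : \sum_(x in A) x = \sum_(x in S) x + \sum_(x in A :\: S) x.
  by rewrite (big_setID S) (setIidPr sSA).
by apply: (addrI (\sum_(x in S) x)); rewrite -E sumS subrK.
Qed.

Lemma restricted_sumsetU k m A F y : F \subset A ->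
  y \in restricted_sumset m (A :\: F) -> (m + #|F| = k)%N ->
  y + \sum_(x in F) x \in restricted_sumset k A.
Proof.
move=> sFA /restricted_sumsetP[S [sS cS <-]] <-; apply/restricted_sumsetP.
have dis : [disjoint S & F] by move: sS; rewrite subsetD => /andP[].
exists (S :|: F); split.
- by rewrite subUset sFA (subset_trans sS (subsetDl _ _)).
- by rewrite cardsU disjoint_setI0 // cards0 subn0 cS.
- by rewrite -bigU //; apply: eq_bigl => x; rewrite !inE.
Qed.

(** * Two-term representations and filling with pairs *)

Definition summands A z := [set c in A | z - c \in A].

Definition pairs A z := [set c in A | (z - c \in A) && (z - c != c)].

(** Pairs {c, z - c} are added greedily: [S], its reflection z - S and i pairs already chosen block
    at most 2m + 2i elements of [pairs A z]. *)
Lemma restricted_sumset_pairs A z m j y :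
  y \in restricted_sumset m A -> (m.*2 + j.*2 <= #|pairs A z|)%N ->
  y + z *+ j \in restricted_sumset (m + j.*2) A.
Proof.
move=> /restricted_sumsetP[S [sS cS <-]] hj.
(* Closure of [Q] under c |-> z - c is carried along so that a new c outside [Q] has its partner
   outside [Q] too. *)
suff [Q [sQ cQ sumQ _]] : exists Q : {set G},
    [/\ Q \subset A :\: S, #|Q| = j.*2, \sum_(x in Q) x = z *+ j
      & forall c, c \in Q -> z - c \in Q].
  have dQS : [disjoint Q & S] by move: sQ; rewrite subsetD => /andP[].
  apply/restricted_sumsetP; exists (S :|: Q); split.
  - by rewrite subUset sS (subset_trans sQ (subsetDl _ _)).
  - by rewrite cardsU disjoint_setI0 1?disjoint_sym // cards0 subn0 cS cQ.
  - by rewrite -sumQ -bigU 1?disjoint_sym //; apply: eq_bigl => x; rewrite !inE.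
elim: j hj => [|j IHj] hj.
  exists set0; split; rewrite ?sub0set ?cards0 ?big_set0 ?mulr0n //.
  by move=> c; rewrite inE.
have [|Q [sQ cQ sumQ invQ]] := IHj; first by apply: leq_trans hj; lia.
pose I := [set z - s | s in S].
have /subsetPn[c] : ~~ (pairs A z \subset S :|: I :|: Q).
  have b : (#|S :|: I :|: Q| <= m + m + j.*2)%N.
    rewrite (leq_trans (leq_card_setU _ _)) // cQ leq_add2r.
    rewrite (leq_trans (leq_card_setU _ _)) // cS leq_add2l -cS.
    exact: leq_imset_card.
  apply/negP => /subset_leq_card le; have := leq_trans hj (leq_trans le b); lia.
rewrite !inE => /and3P[cA zcA ne].
rewrite !negb_or => /andP[/andP[cS' cI] cQ'].
have zS : z - c \notin S.
  by apply: contra cI => zcS; apply/imsetP; exists (z - c); rewrite ?subKr.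
have zQ : z - c \notin Q by apply: contra cQ' => /invQ; rewrite subKr.
exists (c |: ((z - c) |: Q)); split.
- by rewrite !subUset !sub1set sQ !inE cA zcA cS' zS.
- rewrite !cardsU1 !inE (eq_sym c) (negPf ne) (negPf cQ') (negPf zQ) cQ /=; lia.
- rewrite !big_setU1 ?inE ?negb_or ?(eq_sym c) ?ne //= sumQ addrA subrKC.
  by rewrite mulrS.
- move=> e; rewrite !inE => /or3P[/eqP->|/eqP->|/invQ ->]; rewrite ?eqxx ?orbT //.
  by rewrite subKr eqxx.
Qed.

Lemma restricted_sumset2 A y : (0 < #|pairs A y|)%N -> y \in restricted_sumset 2 A.
Proof.
case/card_gt0P => c; rewrite !inE => /and3P[cA ycA ne].
apply/restricted_sumsetP; exists [set c; y - c]; split.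
- by rewrite subUset !sub1set cA.
- by rewrite cards2 eq_sym ne.
- by rewrite big_setU1 /= ?big_set1 ?subrKC // inE eq_sym.
Qed.

Lemma card_pairs_setD1 A b z : (#|pairs A z| <= #|pairs (A :\ b) z| + 2)%N.
Proof.
have sub : pairs A z \subset pairs (A :\ b) z :|: [set b; z - b].
  apply/subsetP => c; rewrite !inE => /and3P[-> -> ->].
  have [//|_] := eqVneq c b; have [|czb] := eqVneq c (z - b); rewrite ?orbT //.
  by have -> : z - c != b by apply: contra_neq czb => <-; rewrite subKr.
apply: leq_trans (subset_leq_card sub) _; apply: leq_trans (leq_card_setU _ _) _.
by rewrite leq_add2l cards2; case: (_ != _).
Qed.

(** The solutions of 2c = z are empty or a coset of G[2]. *)
Lemma card_halves z : (#|[set c : G | c *+ 2 == z]| <= #|two_torsion G|)%N.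
Proof.
have [->|[c0]] := set_0Vmem [set c : G | c *+ 2 == z]; first by rewrite cards0.
rewrite inE => /eqP c0z.
rewrite -(card_imset _ (@subIr _ c0)); apply/subset_leq_card/subsetP => e /imsetP[c].
by rewrite !inE => /eqP cz ->; rewrite mulrnBl cz c0z subrr.
Qed.

Lemma card_summands_pairs A z :
  (#|summands A z| <= #|pairs A z| + #|two_torsion G|)%N.
Proof.
have sub : summands A z \subset pairs A z :|: [set c : G | c *+ 2 == z].
  apply/subsetP => c; rewrite !inE => /andP[-> ->] /=.
  by rewrite subr_eq mulr2n (eq_sym z) orNb.
apply: leq_trans (subset_leq_card sub) _; apply: leq_trans (leq_card_setU _ _) _.
by rewrite leq_add2l card_halves.
Qed.

(** Two distinct elements of A \ {b} with sum x - b would give x together with b. So only halves of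
    x - b, at most |G[2]|, and the terms b and x - 2b remain. *)
Lemma card_summands_not3 A x b : x \notin restricted_sumset 3 A -> b \in A ->
  (#|summands A (x - b)%R| <= #|two_torsion G| + 2)%N.
Proof.
move=> x3 bA; apply: leq_trans (card_summands_pairs _ _) _.
rewrite addnC leq_add2l; apply: leq_trans (card_pairs_setD1 _ b _) _.
rewrite -[leqRHS]add0n leq_add2r leqNgt; apply: contra x3 => /restricted_sumset2 h.
have := @restricted_sumsetU 3 _ A [set b] _ _ h; rewrite big_set1 subrK.
by apply; rewrite ?sub1set ?cards1.
Qed.

Lemma exchange_card (P : pred G) (Q : G -> G -> bool) A :
  (\sum_(z | P z) #|[set c in A | Q c z]| =
   \sum_(c in A) #|[set z | P z & Q c z]|)%N.
Proof.
under eq_bigr do rewrite -sum1_card.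
under [RHS]eq_bigr do rewrite -sum1_card.
rewrite (exchange_big_dep (mem A)) /=; last by move=> z c _; rewrite inE => /andP[].
by apply: eq_bigr => c cA; apply: eq_bigl => z; rewrite !inE cA.
Qed.

Lemma card_shift A c : #|[set z | z - c \in A]| = #|A|.
Proof.
rewrite -(card_imset A (@addIr _ c)); apply: eq_card => z; rewrite inE.
apply/idP/imsetP => [h|[y yA ->]]; last by rewrite addrK.
by exists (z - c); rewrite ?subrK.
Qed.

Lemma sum_card_summands A : (\sum_z #|summands A z| = #|A| * #|A|)%N.
Proof.
rewrite exchange_card -sum_nat_const; apply: eq_bigr => c _.
by rewrite -(card_shift A c); apply: eq_card => z; rewrite !inE.
Qed.

Lemma sum_card_pairs A : (\sum_z #|pairs A z| = #|A| * (#|A| - 1))%N.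
Proof.
rewrite exchange_card -sum_nat_const; apply: eq_bigr => c cA.
rewrite (cardsD1 c A) cA addKn -(card_shift (A :\ c) c).
by apply: eq_card => z; rewrite !inE /= andbC.
Qed.

Lemma card_summands_le A z : (#|summands A z| <= #|A|)%N.
Proof. by apply/subset_leq_card/subsetP => c; rewrite inE => /andP[]. Qed.

Lemma exists_many_pairs A : exists z, (#|A| * (#|A| - 1) <= #|pairs A z| * #|G|)%N.
Proof.
have [z _ zmax] := @arg_maxnP _ 0 xpredT (fun z => #|pairs A z|) isT.
exists z; rewrite -sum_card_pairs mulnC -sum_nat_const.
by apply: leq_sum => y _; apply: zmax.
Qed.

(** * Index 2 subgroups and near-periods *)

(* The first clause says that membership in L is a homomorphism to Z/2. *)
Definition index2 (L : {set G}) : Prop :=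
  (forall u v, (u - v \in L) = ((u \in L) == (v \in L))) /\ (#|L| * 2 = #|G|)%N.

Lemma card_reflect A c : #|[set z | c - z \in A]| = #|A|.
Proof.
rewrite -(card_imset A (@subrI _ c)); apply: eq_card => z; rewrite inE.
apply/idP/imsetP => [h|[y yA ->]]; last by rewrite subKr.
by exists (c - z); rewrite ?subKr.
Qed.

(* W, W + u and W + v are too large to be pairwise disjoint, so one of u, v and
   u - v lies in W - W. *)
Lemma index2_small_values (d : G -> nat) (e : nat) (W : {set G}) :
  (forall h, d (- h) = d h) ->
  (forall h h', d (h + h')%R <= d h + d h')%N ->
  (#|G| < 3 * #|W|)%N ->
  (forall z z', z \in W -> z' \in W -> (d (z - z')%R <= e)%N) ->
  (exists h, 3 * e < d h)%N ->
  index2 [set h : G | (d h <= e)%N].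
Proof.
move=> dN dD W3 dW [h0 h0e]; set L := [set h | _].
have LN u : (- u \in L) = (u \in L) by rewrite !inE dN.
have key u v : u \notin L -> v \notin L -> u - v \in L.
  move=> uL vL; apply/negPn/negP => uvL.
  pose T a := [set z | z - a \in W].
  have dis a b : a - b \notin L -> T a :&: T b = set0.
    apply: contraNeq => /set0Pn[z].
    rewrite !inE => /andP[za zb]; have := dW _ _ zb za.
    by rewrite opprB addrC addrA subrK.
  have : (#|T 0%R :|: T u :|: T v| <= #|G|)%N by apply: max_card.
  rewrite cardsU setIUl (dis 0) ?sub0r ?LN // (dis u) // setU0 cardsU.
  rewrite (dis 0) ?sub0r ?LN // !cards0 !subn0 !card_shift; lia.
have LD u v : u \in L -> v \in L -> u + v \in L.
  rewrite [u \in L]inE [v \in L]inE => uL vL.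
  apply/negPn/negP => uvL; have uv2 := dD u v.
  have : (d h0 <= 3 * e)%N; last by rewrite leqNgt h0e.
  have [|h0L] := boolP (h0 \in L); first by rewrite inE; lia.
  have := key _ _ uvL h0L; rewrite -LN opprB inE => h1.
  rewrite -(subrK (u + v) h0) (leq_trans (dD _ _)) // mulSn leq_add //.
  by rewrite (leq_trans uv2) // mul2n -addnn leq_add.
have LE u v : (u - v \in L) = ((u \in L) == (v \in L)).
  have [uL|uL] := boolP (u \in L); have [vL|vL] := boolP (v \in L).
  - by rewrite LD ?LN.
  - apply: contraNF vL => uvL; rewrite -LN -[- v](addKr u) LD ?LN //.
  - apply: contraNF uL => uvL; by rewrite -(subrK v u) LD.
  - by rewrite key.
split=> //.
have h0L : h0 \notin L by rewrite inE -ltnNge; lia.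
rewrite -(cardsC L) muln2 -addnn; congr addn.
rewrite -(card_shift L h0); apply: eq_card => z.
by rewrite in_setC -eqbF_neg -(negPf h0L) -LE !inE.
Qed.

(** This is A \ (A + h). Its size is symmetric and subadditive in h, as [index2_small_values] asks
    of [d]. *)
Definition defect A h := [set c in A | c - h \notin A].

Lemma card_defectE A h :
  (#|defect A h| = #|A| - #|[set c in A | (c - h)%R \in A]|)%N.
Proof.
have -> : defect A h = A :\: [set c in A | c - h \in A].
  by apply/setP => c; rewrite !inE; case: (c \in A); rewrite ?andbT ?andbF.
by rewrite cardsDS //; apply/subsetP => c; rewrite inE => /andP[].
Qed.

Lemma card_defectN A h : #|defect A (- h)| = #|defect A h|.
Proof.
rewrite !card_defectE; congr subn.
rewrite -(card_imset _ (@subIr _ (- h))); apply: eq_card => c.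
rewrite !inE; apply/imsetP/andP => [[b]|[cA chA]].
  by rewrite inE => /andP[bA bhA] ->; rewrite opprK in bhA *; rewrite addrK.
by exists (c - h); rewrite ?inE opprK subrK ?chA.
Qed.

Lemma card_defectD A h h' :
  (#|defect A (h + h')%R| <= #|defect A h| + #|defect A h'|)%N.
Proof.
rewrite -(card_shift (defect A h') h); apply: leq_trans (leq_card_setU _ _).
apply/subset_leq_card/subsetP => c; rewrite !inE opprD addrA => /andP[-> ->].
by rewrite andbT orNb.
Qed.

(** Translation by -(z - z') is the reflection c |-> z - c followed by c |-> z' - c; each reflection
    loses the elements of [A] that are not summands. *)
Lemma card_defect_summands A z z' :
  (#|defect A (z - z')%R| <=
   (#|A| - #|summands A z|) + (#|A| - #|summands A z'|))%N.
Proof.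
have E y : (#|A| - #|summands A y| = #|A :\: summands A y|)%N.
  by rewrite cardsDS //; apply/subsetP => c; rewrite inE => /andP[].
rewrite !E -(card_reflect (A :\: summands A z') z).
apply: leq_trans (leq_card_setU _ _).
apply/subset_leq_card/subsetP => c; rewrite !inE => /andP[-> hc].
rewrite andbT; case: (z - c \in A) => //=; rewrite andbT.
by congr (_ \notin A) : hc; rewrite !opprB addrC addrA addrAC addrC.
Qed.

Lemma sum_card_defect A : (\sum_h #|defect A h| = #|A| * (#|G| - #|A|))%N.
Proof.
rewrite exchange_card -sum_nat_const; apply: eq_bigr => c _.
rewrite -(cardsC A) addKn -(card_reflect (~: A) c).
by apply: eq_card => h; rewrite !inE.
Qed.

(* For z in x - A there are few representations of z as a sum over A, so most
   of the |A|^2 representations have z outside x - A. There are only about |A|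
   such z, hence for most of them c |-> z - c almost preserves A. *)
Lemma many_reflections A x :
  x \notin restricted_sumset 3 A -> (#|G| <= 2 * #|A| + 7)%N ->
  (190 * (#|two_torsion G| + 12) <= #|G|)%N ->
  (2 * #|A| <= #|G| + #|two_torsion G| + 2)%N /\
  (#|G| < 3 * #|[set z | 25 * (#|A| - #|summands A z|) <= #|G|]|)%N.
Proof.
move=> x3 gA tG; set W := [set z | _]; set t := #|two_torsion G|.
pose N := [set z | x - z \in A]; have cN : #|N| = #|A| by apply: card_reflect.
have aG : (#|A| <= #|G|)%N by apply: max_card.
have cNC : (#|~: N| = #|G| - #|A|)%N by rewrite -(cardsC N) cN addKn.
have inN : (\sum_(z in N) #|summands A z| <= #|A| * (t + 2))%N.
  rewrite -cN -sum_nat_const; apply: leq_sum => z; rewrite inE => zA.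
  by rewrite -(subKr x z); apply: card_summands_not3.
have splitN : (\sum_(z in N) #|summands A z| + \sum_(z in ~: N) #|summands A z|
               = #|A| * #|A|)%N.
  rewrite -sum_card_summands [RHS](bigID (mem N)) /=; congr addn.
  by apply: eq_bigl => z; rewrite inE.
have outN : (\sum_(z in ~: N) (#|A| - #|summands A z|)
             + \sum_(z in ~: N) #|summands A z| = (#|G| - #|A|) * #|A|)%N.
  rewrite -big_split /= -cNC -sum_nat_const; apply: eq_bigr => z _.
  by rewrite subnK // card_summands_le.
(* Markov's inequality: each z outside [W] misses more than |G|/25 representations. *)
have bad : (#|~: N :\: W| * #|G| <=
            25 * \sum_(z in ~: N) (#|A| - #|summands A z|))%N.
  rewrite -sum_nat_const big_distrr /= [X in (_ <= X)%N](big_setID W) /=.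
  apply: leq_trans (leq_addl _ _); apply: leq_sum => z.
  by rewrite !inE -ltnNge => /andP[/ltnW].
have WN : (#|~: N| <= #|W| + #|~: N :\: W|)%N.
  by rewrite -(cardsID W (~: N)) leq_add2r subset_leq_card // subsetIr.
move: tG inN splitN outN bad WN; rewrite -/t cNC.
set S1 := (\sum_(z in N) _)%N; set S2 := (\sum_(z in ~: N) #|_|)%N.
set S3 := (\sum_(z in ~: N) _)%N; set w := #|W|; set b := #|_ :\: _|.
move: #|A| #|G| aG gA => a g aG gA tG inN splitN outN bad WN.
have a0 : (0 < a)%N by lia.
have aa : (a * a <= g * a)%N by rewrite leq_mul2r aG orbT.
have ag : (2 * a <= g + t + 2)%N.
  rewrite leqNgt; apply/negP => h.
  have : (a * (2 * a) <= a * (g + t + 2))%N by rewrite mulnBl in outN; lia.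
  by rewrite leq_pmul2l // leqNgt h.
have S3le : (S3 <= a * (t + 9))%N.
  have : (a * g <= a * (2 * a + 7))%N by rewrite leq_pmul2l.
  by rewrite mulnBl in outN; lia.
(* From b g <= 25 a (t + 9) and g >= 190 (t + 12). So b is a small part of a, and w >= g - a - b
   exceeds g/3. *)
have b190 : (b * 190 <= 25 * a)%N.
  rewrite -(@leq_pmul2r (t + 12)); last by lia.
  have : (b * (190 * (t + 12)) <= b * g)%N by rewrite leq_mul2l tG orbT.
  lia.
by split=> //; lia.
Qed.

Lemma near_coset A x :
  x \notin restricted_sumset 3 A -> (#|G| <= 2 * #|A| + 7)%N ->
  (190 * (#|two_torsion G| + 12) <= #|G|)%N ->
  (2 * #|A| <= #|G| + #|two_torsion G| + 2)%N /\
  exists L u, index2 L /\ (4 * #|L| <= 5 * #|[set c in A | (c - u)%R \in L]|)%N.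
Proof.
move=> x3 gA tG; have [ag] := many_reflections x3 gA tG.
set W := [set z | _] => W3; split=> //.
(* Two elements of [W] miss at most |G|/25 representations each. *)
pose e := (2 * #|G| %/ 25)%N; have e25 : (e * 25 <= 2 * #|G|)%N by apply: leq_divM.
have LE : index2 [set h : G | (#|defect A h| <= e)%N].
  apply: (@index2_small_values _ _ W) W3 _ _ => [h|h h'|z z'|].
  - exact: card_defectN.
  - exact: card_defectD.
  - rewrite !inE => zW z'W; rewrite leq_divRL //.
    by have := card_defect_summands A z z'; lia.
  - apply/existsP; apply: contraT; rewrite negb_exists => /forallP small; exfalso.
    apply: (not_almost_invariant gA tG ag e25).
    rewrite -sum_card_defect -sum_nat_const.
    by apply: leq_sum => h _; rewrite leqNgt.
set L := [set h | _] in LE; have [LB L2] := LE.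
(* The coset of [L] holding the larger part of [A]; its representative is 0 or any w outside [L]. *)
have [u uC] : exists u, (#|A| <= 2 * #|[set c in A | (c - u)%R \in L]|)%N.
  have [E|[w]] := set_0Vmem (~: L).
    move: tG; rewrite -(cardsC L) E cards0 addn0; move: L2.
    by rewrite -(cardsC L) E cards0 muln2 -addnn => /addnI ->; lia.
  rewrite inE => wL.
  have : (#|[set c in A | (c - 0)%R \in L]|
          + #|[set c in A | (c - w)%R \in L]| = #|A|)%N.
    rewrite -(cardsID L A); congr addn; apply: eq_card => c; rewrite !inE.
      by rewrite subr0.
    have := LB c w; rewrite (negPf wL) eqbF_neg !inE => ->.
    by rewrite andbC.
  move=> E.
  have [h|h] := leqP #|A| (2 * #|[set c in A | (c - 0)%R \in L]|).
    by exists 0.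
  by exists w; lia.
exists L, u; split=> //; set C := [set c in A | _].
(* For h in [L], c - h runs through the coset u + L, which meets [A] only in [C]. *)
have fiber c : c \in C ->
  (#|L| - #|C| <= #|[set h | h \in L & (c - h)%R \notin A]|)%N.
  rewrite inE => /andP[_ cu].
  have shiftL h : (c - h - u \in L) = (h \in L).
    by rewrite addrAC LB cu.
  have sub : [set h | c - h \in C] \subset L.
    by apply/subsetP => h; rewrite [h \in _]inE [_ \in C]inE shiftL => /andP[].
  rewrite -(card_reflect C c) -cardsDS //; apply/subset_leq_card/subsetP => h.
  rewrite in_setD ![h \in [set _ | _]]inE [_ \in C]inE shiftL => /andP[+ hL].
  by rewrite inE hL andbT.
have CL : (#|C| <= #|L|)%N.
  rewrite -(card_shift L u); apply/subset_leq_card/subsetP => c.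
  by rewrite !inE => /andP[].
apply: (dense_of_almost_invariant L2 gA uC _ e25 CL); first by lia.
apply: (@leq_trans (\sum_(h in L) #|defect A h|)); last first.
  by rewrite -sum_nat_const; apply: leq_sum => h; rewrite inE.
rewrite exchange_card [X in (_ <= X)%N](big_setID C) /=.
apply: leq_trans (leq_addr _ _); rewrite -sum_nat_const.
have -> : A :&: C = C by apply/setIidPr/subsetP => c; rewrite inE => /andP[].
by apply: leq_sum => c /fiber.
Qed.

(** * Sums inside a coset of an index 2 subgroup *)

Lemma restricted_sumsetS k A C : A \subset C ->
  restricted_sumset k A \subset restricted_sumset k C.
Proof.
move=> AC; apply/subsetP => y /restricted_sumsetP[S [SA cS sS]].
by apply/restricted_sumsetP; exists S; rewrite (subset_trans SA AC).
Qed.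

(** Since 2u and z are in [L], both C and z - C lie in u + L, so they overlap in at least 2|C| - |L|
    elements. *)
Lemma card_pairs_coset L u C z : index2 L -> (forall c, c \in C -> c - u \in L) ->
  z \in L -> (2 * #|C| <= #|L| + #|two_torsion G| + #|pairs C z|)%N.
Proof.
move=> [LB _] CL zL; pose C' := [set c : G | z - c \in C].
have sub : C :|: C' \subset [set c : G | c - u \in L].
  apply/subsetP => c; rewrite !inE => /orP[/CL //|/CL].
  by rewrite !LB zL; case: (c \in L); case: (u \in L).
have := subset_leq_card sub; rewrite card_shift => cardL.
have summE : C :&: C' = summands C z by apply/setP => c; rewrite !inE.
have := card_summands_pairs C z; rewrite -summE.
have := cardsUI C C'; rewrite (card_reflect C z); lia.
Qed.

(** One pair has sum y, the other j pairs have sum 0; both sums lie in [L]. *)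
Lemma restricted_sumset_coset_even L u C j y :
  index2 L -> (forall c, c \in C -> c - u \in L) -> y \in L ->
  (#|L| + #|two_torsion G| + 4 + j.*2 <= 2 * #|C|)%N ->
  y \in restricted_sumset (2 + j.*2) C.
Proof.
move=> iL CL yL cardC.
rewrite -[y]addr0 -(mul0rn G j); apply: restricted_sumset_pairs.
  by apply: restricted_sumset2; have := card_pairs_coset iL CL yL; lia.
have L0 : 0 \in L by rewrite -(subrr y) iL.1 eqxx.
rewrite -(leq_add2l (#|L| + #|two_torsion G|)).
by apply: leq_trans (card_pairs_coset iL CL L0); lia.
Qed.

(** [u *+ odd m] represents the class of a sum of m elements of u + L. For odd m, one element of [C]
    is set aside first. *)
Lemma restricted_sumset_coset L u C m y :
  index2 L -> (forall c, c \in C -> c - u \in L) -> (2 <= m)%N ->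
  y - u *+ odd m \in L ->
  (#|L| + #|two_torsion G| + 4 + m <= 2 * #|C|)%N ->
  y \in restricted_sumset m C.
Proof.
move=> iL CL m2 yL cardC; pose j := (m - 2)./2.
have [mo|me] := boolP (odd m); last first.
  have -> : m = (2 + j.*2)%N by rewrite /j; lia.
  apply: restricted_sumset_coset_even iL CL _ _; last by rewrite /j; lia.
  by move: yL; rewrite (negPf me) mulr0n subr0.
have /card_gt0P[c cC] : (0 < #|C|)%N by lia.
rewrite -(subrK c y) -(big_set1 +%R c (fun x => x)).
have := @restricted_sumsetU m (2 + j.*2)%N C [set c] (y - c).
rewrite big_set1; apply; rewrite ?sub1set ?cards1 //; last by rewrite /j; lia.
apply: (restricted_sumset_coset_even iL (u := u)).
- by move=> b; rewrite inE => /andP[_ /CL].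
- move: yL (CL _ cC); rewrite mo mulr1n !iL.1.
  by case: (y \in L); case: (c \in L); case: (u \in L).
- by have := cardsD1 c C; rewrite cC /j; lia.
Qed.

(** * Choice of the filler and the case 2k <= |A| *)

Lemma exists_subset_card A f : (f <= #|A|)%N ->
  exists F : {set G}, F \subset A /\ #|F| = f.
Proof.
case/card_geqP => s [us <- sA]; exists [set c in s]; split.
  by apply/subsetP => c; rewrite inE => /sA.
by rewrite cardsE; apply/card_uniqP.
Qed.

(* The best z is only guaranteed [k <= #|pairs A z|]. When that is tight, some of
   the k summands are spent on a set F outside the pairs, which saves pairs. *)
Lemma exists_filler A k : (3 <= k)%N -> (2 * k <= #|A|)%N ->
  (#|G| < 2 * #|A|)%N -> (100 <= #|G|)%N ->
  exists z F j, [/\ F \subset A, #|F| <= 4, 3 + j.*2 + #|F| = k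
                  & 3.*2 + j.*2 <= #|pairs (A :\: F) z|]%N.
Proof.
move=> k3 kA gA g100; have [z hz] := exists_many_pairs A; exists z.
set P := pairs A z in hz *.
have PA : P \subset A by apply/subsetP => c; rewrite inE => /andP[].
have aq : (#|A| <= 2 * #|P| + 1)%N.
  move: hz; move: #|A| #|P| #|G| gA => a q g gA hz.
  rewrite leqNgt; apply/negP => lt.
  have : (2 * q * g <= (a - 2) * (2 * a - 1))%N by apply: leq_mul; lia.
  have [b ab] : exists b, (a = b + 2)%N by exists (a - 2)%N; lia.
  have [-> E] : (a - 2 = b)%N /\ (a - 1 = b + 1)%N by lia.
  by move: hz; rewrite E ab; lia.
have kq : (k <= #|P|)%N by lia.
have [/andP[k7 PA4]|small] := boolP ((6 < k) && (3 < #|A :\: P|))%N.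
  have [|F [FAP cF]] := @exists_subset_card (A :\: P) (3 + odd k).
    by case: (odd k); lia.
  exists F, ((k - 6)./2)%N; rewrite cF; split.
  - exact: subset_trans FAP (subsetDl _ _).
  - by case: (odd k).
  - by lia.
  apply: (@leq_trans #|P|); first by lia.
  have FP c : c \in P -> c \notin F.
    by move=> cP; apply: contraL cP => /(subsetP FAP); rewrite inE => /andP[].
  apply/subset_leq_card/subsetP => c cP; have := cP.
  rewrite inE => /and3P[cA zcA ne].
  have zcP : z - c \in P by rewrite inE zcA subKr cA eq_sym.
  by rewrite !inE cA zcA ne !FP.
(* Now [F] only fixes parity: 6 + 2j <= k + 3, and removing one element of [A] costs at most 2
   elements of [P]. *)
have big : (k + 5 <= #|P|)%N.
  move: small; rewrite negb_and -!leqNgt => /orP[k6|AP3]; first by lia.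
  by move: AP3; rewrite cardsDS //; lia.
have [F [FA cF]] : exists F : {set G}, F \subset A /\ #|F| = ~~ odd k.
  by apply: exists_subset_card; case: (odd k); lia.
exists F, ((k - 3)./2)%N; rewrite cF; split=> //.
- by case: (odd k).
- by lia.
have : (#|P| <= #|pairs (A :\: F) z| + 2)%N.
  case: (odd k) cF => /= /eqP.
    by rewrite cards_eq0 => /eqP ->; rewrite setD0 leq_addr.
  by case/cards1P => b ->; apply: card_pairs_setD1.
by lia.
Qed.

Lemma restricted_sumset_half A k x : (3 <= k)%N -> (2 * k <= #|A|)%N ->
  (#|G| < 2 * #|A|)%N -> (190 * (#|two_torsion G| + 12) <= #|G|)%N ->
  x \in restricted_sumset k A.
Proof.
move=> k3 kA gA tG; have g100 : (100 <= #|G|)%N by lia.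
have [z [F [j [FA F4 jk Pj]]]] := exists_filler k3 kA gA g100.
apply/negPn/negP => xk.
pose x' := x - \sum_(c in F) c - z *+ j.
have x3 : x' \notin restricted_sumset 3 (A :\: F).
  apply: contra xk => x'3; rewrite -(subrK (\sum_(c in F) c) x).
  apply: restricted_sumsetU FA _ jk.
  rewrite -(subrK (z *+ j) (x - _)); exact: restricted_sumset_pairs.
have cAF : (#|A :\: F| = #|A| - #|F|)%N by rewrite cardsDS.
have [|agF [L [u [iL CL]]]] := near_coset x3 _ tG; first by lia.
set C := [set c in A :\: F | _] in CL.
have CA : C \subset A by apply/subsetP => c; rewrite !inE => /andP[/andP[]].
have Cu c : c \in C -> c - u \in L by rewrite inE => /andP[].
have L2 := iL.2.
(* There is room because k is at most about |L|/2, while 2|C| >= 8|L|/5. *)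
have dense m y : (2 <= m)%N -> (m <= k)%N -> y - u *+ odd m \in L ->
    y \in restricted_sumset m C.
  by move=> m2 mk yL; apply: (restricted_sumset_coset iL Cu) => //; lia.
have [xL|xL] := boolP (x - u *+ odd k \in L).
  by move: xk; rewrite (subsetP (restricted_sumsetS _ CA)) // dense //; lia.
(* When x is in the wrong class, one summand v from the other coset corrects it; v exists since |A|
   > |G|/2 = |L|. *)
have /subsetPn[v vA] : ~~ (A \subset [set c | c - u \in L]).
  by apply/negP => /subset_leq_card; rewrite card_shift; lia.
rewrite inE => vL; move: xk; rewrite -(subrK v x) -{2}(big_set1 +%R v id).
rewrite (@restricted_sumsetU k (k - 1)) ?sub1set ?cards1 //; last by lia.
apply: (subsetP (restricted_sumsetS _ _)) (dense _ _ _ _ _); try lia.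
  apply/subsetP => c cC; rewrite !inE (subsetP CA) // andbT.
  by apply: contraNneq vL => <-; apply: Cu.
have -> : odd (k - 1) = ~~ odd k by lia.
move: xL vL; case: (odd k); rewrite /= ?mulr0n ?mulr1n ?subr0 !iL.1;
  by case: (x \in L); case: (v \in L); case: (u \in L).
Qed.

(** * Two-torsion and the numerical hypotheses *)

(** Translation by x permutes [G], hence preserves the sum of all elements. *)
Lemma mulrn_card (x : G) : x *+ #|G| = 0.
Proof.
apply: (addrI (\sum_(y : G) y)).
rewrite addr0 [RHS](reindex_inj (addIr x)) /= big_split /=; congr +%R.
by rewrite sumr_const; congr (x *+ _); apply: eq_card.
Qed.

Lemma card_two_torsion_odd : odd #|G| -> #|two_torsion G| = 1%N.
Proof.
move=> oG; apply/eqP/cards1P; exists 0; apply/setP => x; rewrite !inE.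
apply/eqP/eqP => [x2|->]; last by rewrite mul0rn.
rewrite -(mulrn_card x) -[#|G|]odd_double_half oG mulrnDr mulr1n.
by rewrite -mul2n mulrnA x2 mul0rn addr0.
Qed.

Lemma card_two_torsion_gt0 : (0 < #|two_torsion G|)%N.
Proof. by apply/card_gt0P; exists 0; rewrite inE mul0rn. Qed.

End Sumsets.

(** With t = |G[2]|, for even order 624t + 1846 >= 190t + 2280 as t >= 1, with equality at t = 1.
    For odd order t = 1, and 190 * 13 = 2470 is below every bound. *)
Lemma two_torsion_bound (G : finZmodType) :
  (smallest_prime_divisor G = 2 -> 624 * #|two_torsion G| + 1846 <= #|G|) ->
  (smallest_prime_divisor G = 3 -> 3705 <= #|G|) ->
  (smallest_prime_divisor G = 5 -> 6175 <= #|G|) ->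
  (7 <= smallest_prime_divisor G -> 46319 <= #|G|) ->
  1 < #|G| -> 190 * (#|two_torsion G| + 12) <= #|G|.
Proof.
rewrite /smallest_prime_divisor => h2 h3 h5 h7 g1.
have pp := pdiv_prime g1; have t0 := card_two_torsion_gt0 G.
have [/eqP p2|p2] := boolP (pdiv #|G| == 2); first by have := h2 p2; lia.
have oG : odd #|G|.
  apply: contraR p2; rewrite -dvdn2 => d2.
  by rewrite eqn_leq pdiv_min_dvd // prime_gt1.
rewrite (card_two_torsion_odd oG).
move: pp p2 h3 h5 h7.
case: (pdiv #|G|) => [|[|[|[|[|[|[|p]]]]]]] // _ _ h3 h5 h7.
- by apply: leq_trans (h3 _).
- by apply: leq_trans (h5 _).
- by apply: leq_trans (h7 _).
Qed.

Theorem theoremA (G : finZmodType)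
  (h2 : smallest_prime_divisor G = 2 -> 624 * #|two_torsion G| + 1846 <= #|G|)
  (h3 : smallest_prime_divisor G = 3 -> 3705 <= #|G|)
  (h5 : smallest_prime_divisor G = 5 -> 6175 <= #|G|)
  (h7 : 7 <= smallest_prime_divisor G -> 46319 <= #|G|)
  (A : {set G}) (hA : #|G| < 2 * #|A|)
  (k : nat) (hk3 : 3 <= k) (hkA : k <= #|A| - 3) :
  restricted_sumset k A = [set: G].
Proof.
(* The trivial group, to which none of the four bounds applies, is excluded because 3 <= k <= |A| -
   3 forces |A| >= 6. *)
have g1 : 1 < #|G|.
  have : #|A| <= #|G| by apply: max_card.
  lia.
have tG := two_torsion_bound h2 h3 h5 h7 g1.
have half m x : 3 <= m -> 2 * m <= #|A| -> x \in restricted_sumset m A.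
  by move=> m3 mA; apply: restricted_sumset_half.
apply/setP => x; rewrite inE.
have [kA|kA] := leqP (2 * k) #|A|; first exact: half.
by apply: restricted_sumset_compl; [lia | apply: half; lia].
Qed.
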